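(* Let $p$ be a prime greater than $5$. Then $$\sum_{k=0}^{[p/3]}\frac{(3k)!}{54^k\,k!^3}\equiv\begin{cases}0\pmod p&\text{if }6\mid p-5,\\ 2A\pmod p&\text{if }6\mid p-1\text{ and }p=A^2+3B^2\text{ with }A,B\in\mathbb Z,\ 3\mid A-1,\end{cases}$$ and $$\sum_{k=0}^{[p/3]}\frac{k\,(3k)!}{54^k\,k!^3}\equiv\begin{cases}0\pmod p&\text{if }6\mid p-1,\\ \frac13(-1)^{\frac{p+1}6}2^{-\frac{p+1}3}\binom{(p+1)/3}{(p+1)/6}\pmod p&\text{if }6\mid p-5.\end{cases}$$
   Context: $[y]$ is the greatest integer not exceeding $y$. Congruences are between rational numbers whose denominators are prime to $p$. *)

(* Defs.v *)
From HB Require Import structures.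
From mathcomp Require Import all_boot all_order all_algebra.
Set Implicit Arguments. Unset Strict Implicit. Unset Printing Implicit Defensive.
Import Order.TTheory GRing.Theory Num.Theory.
Local Open Scope ring_scope.

Definition rat_eqmod (p : nat) (x y : rat) : Prop :=
  [/\ coprime p `|denq x|%N, coprime p `|denq y|%N
    & (p%:Z %| numq (x - y))%Z].

Definition term (k : nat) : rat :=
  ((3 * k)`!)%:R / ((54 ^ k * (k`!) ^ 3)%N)%:R.

(* Main.v *)
(* In ['F_p] put [n = p %/ 3].  Since [9 n (n + 1) = -2], the [k]-th term of the
   sum becomes [C(n, k) C(n + k, k) (-1/2)^k], so that the first sum is the
   Legendre value P_n(0), i.e. the coefficient of ['X^n] in [2^-n (1 - 'X^2)^n],
   and the second one is the coefficient of ['X^n] in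
   [- n 2^-n (1 + 'X)^2 (1 - 'X^2)^(n-1)].  This settles everything except the
   value of the first sum for [p = 6 m + 1], which is
   [(-1)^m C(2m, m) / 4^m = C(3m, m)] because [2 * 3m = -1].
   Let S(c) be the sum over [x] of [chi (x^3 + c)], [chi] being the quadratic
   character.  By Euler's criterion [S(1) = - C(3m, m)] in ['F_p].  For a
   primitive root [g], computing the sums over [c] of [chi(c) S(c)] and [S(c)^2]
   gives [S(1) - S(g) + S(g^2) = 0] and [S(1)^2 + S(g)^2 + S(g^2)^2 = 6 p]; with
   [S(1)] even and congruent to 1 mod 3, this yields [p = a^2 + 3 b^2] where
   [S(1) = -2 a] and [a = 1] mod 3.  Such an [a] is unique. *)
Require Import Defs.
From HB Require Import structures.
From mathcomp Require Import all_boot all_order all_algebra.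
From mathcomp Require Import finfield cyclic ring zify.
Import Order.TTheory GRing.Theory Num.Theory.
Local Open Scope ring_scope.

(** * Sums of products of binomials at -1/2 as polynomial coefficients *)

Lemma coef_1DX_exp (R : comNzRingType) (n i : nat) :
  ((1 + 'X : {poly R}) ^+ n)`_i = 'C(n, i)%:R.
Proof.
rewrite exprDn coef_sum.
under eq_bigr do rewrite expr1n mul1r coefMn coefXn.
have [le_in|lt_ni] := leqP i n; last first.
  rewrite bin_small // big1 // => k _.
  by rewrite [i == k](gtn_eqF _) ?mul0rn //; have := ltn_ord k; lia.
rewrite (bigD1 (inord i)) //= inordK // eqxx big1 ?addr0 // => k nki.
case: eqP => [eik|_]; last by rewrite mul0rn.
by case/eqP: nki; apply: val_inj; rewrite /= inordK.
Qed.

Lemma coef_1BX2_exp (R : comNzRingType) (n i : nat) :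
  ((1 - 'X^2 : {poly R}) ^+ n)`_i =
  if odd i then 0 else (-1) ^+ i./2 * 'C(n, i./2)%:R.
Proof.
have -> : (1 - 'X^2 : {poly R}) ^+ n
  = \sum_(k < n.+1) ((-1) ^+ k * 'C(n, k)%:R)%:P * 'X^(k.*2).
  rewrite exprDn; apply: eq_bigr => k _.
  rewrite expr1n mul1r -[- 'X^2]mulN1r exprMn -exprM mul2n.
  by rewrite polyCM rmorphXn rmorphN rmorph1 /= rmorph_nat -mulrAC mulr_natr.
rewrite coef_sum; under eq_bigr do rewrite coefCM coefXn.
case: ifPn => [oi|ei].
  rewrite big1 // => k _; case: eqP => [ik|_]; last by rewrite mulr0.
  by rewrite ik odd_double in oi.
have [le_in|lt_ni] := leqP i./2 n; last first.
  rewrite bin_small // mulr0 big1 // => k _.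
  case: eqP => [ik|_]; last by rewrite mulr0.
  by have := ltn_ord k; lia.
rewrite (bigD1 (inord i./2)) //= inordK // even_halfK // eqxx mulr1.
rewrite big1 ?addr0 // => k nki.
case: eqP => [eik|_]; last by rewrite mulr0.
by case/eqP: nki; apply: val_inj; rewrite /= inordK // eik doubleK.
Qed.

Section HalfSums.
Variable F : fieldType.
Hypothesis two_neq0 : 2%:R != 0 :> F.

Lemma half_1DX :
  2%:R%:P * (1 + (- 2%:R^-1)%:P * (1 + 'X)) = 1 - 'X :> {poly F}.
Proof.
rewrite mulrDr mulrA -polyCM mulrN divff // polyCN polyC1.
rewrite polyC_natr; ring.
Qed.

(** Factor [1 - 'X^2] as [(1 + 'X) * (1 - 'X)], write [1 - 'X] as [2 (1 - (1 + 'X) / 2)] and expand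
    the [n]-th power of this factor in powers of [1 + 'X]; the coefficient of ['X^n] in
    [(1 + 'X)^(n + k)] is [C(n + k, k)]. *)
Lemma sum_bin_bin_half (n : nat) :
  2%:R ^+ n * \sum_(k < n.+1) 'C(n, k)%:R * 'C(n + k, k)%:R * (- 2%:R^-1) ^+ k
  = ((1 - 'X^2 : {poly F}) ^+ n)`_n.
Proof.
set y := - 2%:R^-1.
have -> : (1 - 'X^2 : {poly F}) ^+ n
  = (2%:R ^+ n)%:P * \sum_(k < n.+1) ('C(n, k)%:R * y ^+ k)%:P * (1 + 'X) ^+ (n + k).
  rewrite (_ : 1 - 'X^2 = (1 + 'X) * (1 - 'X)); last by ring.
  rewrite -half_1DX -/y !exprMn mulrCA rmorphXn; congr (_ * _).
  rewrite (exprDn 1 (y%:P * _)) mulr_sumr; apply: eq_bigr => k _.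
  rewrite expr1n mul1r exprMn exprD polyCM !rmorphXn /= rmorph_nat -mulr_natl.
  ring.
rewrite coefCM coef_sum; congr (_ * _); apply: eq_bigr => k _.
rewrite coefCM coef_1DX_exp -(@bin_sub (n + k) n) ?leq_addr // addKn; ring.
Qed.

(** The factor [k] is absorbed by [k C(n+1, k) = (n+1) C(n, k-1)]. Shifting [k] then leaves the
    expansion of the previous lemma with an extra [(1 + 'X)^2] and one spare factor [-1/2]. *)
Lemma sum_mul_bin_bin_half (n : nat) :
  2%:R ^+ n.+1 *
    \sum_(k < n.+2) k%:R * ('C(n.+1, k)%:R * 'C(n.+1 + k, k)%:R * (- 2%:R^-1) ^+ k)
  = - n.+1%:R * (((1 + 'X) ^+ 2 * (1 - 'X^2) ^+ n : {poly F}))`_n.+1.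
Proof.
set y := - 2%:R^-1.
have -> : (1 + 'X) ^+ 2 * (1 - 'X^2 : {poly F}) ^+ n
  = (2%:R ^+ n)%:P *
    \sum_(k < n.+1) ('C(n, k)%:R * y ^+ k)%:P * (1 + 'X) ^+ (n.+1 + k.+1).
  rewrite (_ : 1 - 'X^2 = (1 + 'X) * (1 - 'X)); last by ring.
  rewrite -half_1DX -/y !exprMn (mulrCA ((1 + 'X) ^+ n)) [LHS]mulrCA rmorphXn; congr (_ * _).
  rewrite (exprDn 1 (y%:P * _)) !mulr_sumr; apply: eq_bigr => k _.
  rewrite expr1n mul1r exprMn addSnnS -[k.+2]addn2 !exprD polyCM !rmorphXn /=.
  rewrite rmorph_nat -mulr_natl.
  ring.
rewrite big_ord_recl mul0r add0r coefCM coef_sum !mulr_sumr.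
apply: eq_bigr => k _; rewrite lift0.
rewrite coefCM coef_1DX_exp -(@bin_sub (n.+1 + k.+1) n.+1) ?leq_addr // addKn.
have := congr1 (fun i => i%:R : F) (mul_bin_diag n.+1 k); rewrite /= !natrM => e.
rewrite [k.+1%:R * _]mulrA [k.+1%:R * _]mulrA -e !exprS.
have e2 : 2%:R * y = -1 by rewrite /y mulrN divff.
rewrite (_ : - n.+1%:R = (2%:R * y) * n.+1%:R); last by rewrite e2 mulN1r.
ring.
Qed.

Lemma sum_bin_bin_half_odd (n : nat) : odd n ->
  \sum_(k < n.+1) 'C(n, k)%:R * 'C(n + k, k)%:R * (- 2%:R^-1) ^+ k = 0 :> F.
Proof.
move=> on; apply: (mulfI (expf_neq0 n two_neq0)).
by rewrite sum_bin_bin_half coef_1BX2_exp on mulr0.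
Qed.

Lemma sum_bin_bin_half_even (m : nat) :
  4%:R ^+ m *
    \sum_(k < m.*2.+1) 'C(m.*2, k)%:R * 'C(m.*2 + k, k)%:R * (- 2%:R^-1) ^+ k
  = (-1) ^+ m * 'C(m.*2, m)%:R :> F.
Proof.
have -> : 4%:R ^+ m = 2%:R ^+ m.*2 :> F by rewrite -mul2n exprM; congr (_ ^+ _); ring.
by rewrite sum_bin_bin_half coef_1BX2_exp odd_double doubleK.
Qed.

Lemma coef_1DX2_mul (p : {poly F}) (n : nat) :
  ((1 + 'X) ^+ 2 * p)`_n.+2 = p`_n.+2 + 2%:R * p`_n.+1 + p`_n.
Proof.
rewrite (_ : (1 + 'X) ^+ 2 * p = p + 2%:R%:P * ('X * p) + 'X * ('X * p)).
  by rewrite !coefD coefCM !coefXM.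
by rewrite polyC_natr; ring.
Qed.

(** Of the three coefficients picked out by [(1 + 'X)^2], the middle one has odd index and vanishes,
    and the outer two are opposite by the symmetry of the binomials. *)
Lemma sum_mul_bin_bin_half_even (m : nat) :
  \sum_(k < m.*2.+1)
    k%:R * ('C(m.*2, k)%:R * 'C(m.*2 + k, k)%:R * (- 2%:R^-1) ^+ k) = 0 :> F.
Proof.
case: m => [|m]; first by rewrite big_ord1 mul0r.
rewrite doubleS; apply: (mulfI (expf_neq0 m.*2.+2 two_neq0)).
rewrite sum_mul_bin_bin_half mulr0 coef_1DX2_mul !coef_1BX2_exp /=.
rewrite !odd_double /= doubleK exprS.
have -> : 'C(m.*2.+1, m.+1) = 'C(m.*2.+1, m).
  by rewrite -bin_sub; [congr 'C(_, _); lia | lia].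
ring.
Qed.

(** Here the index is odd, so only the middle term [2 'X] of [(1 + 'X)^2] contributes. *)
Lemma sum_mul_bin_bin_half_odd (m : nat) :
  4%:R ^+ m * \sum_(k < m.*2.+2)
    k%:R * ('C(m.*2.+1, k)%:R * 'C(m.*2.+1 + k, k)%:R * (- 2%:R^-1) ^+ k)
  = - (m.*2.+1%:R * (-1) ^+ m * 'C(m.*2, m)%:R) :> F.
Proof.
apply: (mulfI two_neq0); rewrite mulrA.
have -> : 2%:R * 4%:R ^+ m = 2%:R ^+ m.*2.+1 :> F.
  by rewrite exprS -mul2n exprM; congr (_ * _ ^+ _); ring.
rewrite sum_mul_bin_bin_half.
(* [coef_1DX2_mul] needs an index of at least 2, so index 1 is computed directly. *)
case: m => [|m].
  rewrite expr0 !mulr1 coef_1DX_exp bin1.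
  ring.
rewrite doubleS coef_1DX2_mul !coef_1BX2_exp /= !odd_double /= doubleK.
ring.
Qed.

End HalfSums.

(** * Factorials and central binomials when [n] or [N] stands for a fraction *)

(** Induction on [k]: the new factor [(3k+3)(3k+2)(3k+1)] is [3 (k+1) (9 k (k+1) + 2)], and
    replacing [2] by [- 9 n (n+1)] turns it into [-27 (k+1) (n-k) (n+k+1)]. *)
Lemma fact3_bin (R : comNzRingType) (n k : nat) :
  9%:R * (n%:R * (n%:R + 1)) = - 2%:R :> R -> (k <= n)%N ->
  (3 * k)`!%:R = 'C(n, k)%:R * 'C(n + k, k)%:R * (- 27%:R) ^+ k * (k`! ^ 3)%N%:R :> R.
Proof.
move=> hn; elim: k => [|k IHk] lt_kn.
  by rewrite !bin0 !mulr1.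
have e1 := congr1 (fun i => i%:R : R) (mul_bin_left n k).
have e2 := congr1 (fun i => i%:R : R) (mul_bin_diag (n + k).+1 k).
rewrite /= !natrM natrB 1?ltnW // in e1 e2.
rewrite (_ : 3 * k.+1 = (3 * k).+3)%N; last by lia.
rewrite !factS !(natrX, natrM) IHk 1?ltnW // addnS !(natrX, natrM) !exprMn (exprS (- 27%:R)).
transitivity (((k.+1%:R * 'C(n, k.+1)%:R) * (k.+1%:R * 'C((n + k).+1, k.+1)%:R))
   * ((- 27%:R) * (- 27%:R) ^+ k * (k.+1%:R * k`!%:R ^+ 3)) : R).
  2: by ring.
rewrite e1 -e2.
have -> (x : R) : (3 * k).+3%:R * ((3 * k).+2%:R * ((3 * k).+1%:R * x))
  = 3%:R * k.+1%:R * (9%:R * (k%:R * (k%:R + 1)) + 2%:R) * x.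
  rewrite -!natr1 natrM; ring.
rewrite -[2%:R in LHS]opprK -hn -[(n + k).+1]addn1 !natrD.
ring.
Qed.

Lemma mul_central_bin (k : nat) :
  (k.+1 * 'C(k.+1.*2, k.+1) = 2 * k.*2.+1 * 'C(k.*2, k))%N.
Proof.
rewrite doubleS -mul_bin_diag /=.
have <- : 'C(k.*2.+1, k.+1) = 'C(k.*2.+1, k).
  by rewrite -bin_sub; [congr 'C(_, _); lia | lia].
apply/eqP; rewrite -(eqn_pmul2l (ltn0Sn k)) mulnCA -mul_bin_diag /=.
by apply/eqP; lia.
Qed.

(** In [F] the number [N] is [-1/2], and this is the classical [C(-1/2, k) = (-1/4)^k C(2k, k)]. The
    condition on [k!] permits division by each [k+1] in the induction. *)
Lemma central_bin_half (F : fieldType) (N k : nat) :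
  2%:R * N%:R = -1 :> F -> (k <= N)%N ->
  k`!%:R != 0 :> F -> (-1) ^+ k * 'C(k.*2, k)%:R = 4%:R ^+ k * 'C(N, k)%:R :> F.
Proof.
move=> hN; elim: k => [|k IHk] lt_kN; first by rewrite !bin0.
rewrite factS natrM mulf_eq0 negb_or => /andP[k1 kf].
apply: (mulfI k1); have := congr1 (fun i => i%:R : F) (mul_bin_left N k).
rewrite /= !natrM natrB 1?ltnW // => e1.
rewrite [RHS]mulrCA e1 !exprS.
rewrite (_ : 4%:R * 4%:R ^+ k * _ = 4%:R * (N%:R - k%:R) * (4%:R ^+ k * 'C(N, k)%:R)); last by ring.
rewrite -IHk 1?ltnW //.
have := congr1 (fun i => i%:R : F) (mul_central_bin k); rewrite /= !natrM => e3.
rewrite [LHS]mulrCA e3 -[k.*2.+1]addn1 -mul2n natrD natrM.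
transitivity ((-1) ^+ k * 'C(2 * k, k)%:R * (2%:R * (2%:R * N%:R) - 4%:R * k%:R) : F).
  by rewrite hN; ring.
by ring.
Qed.

(** * Cubic character sums over a field with [6 m + 1] elements *)

Lemma sum_periodic (u : nat -> int) (n k : nat) :
  (forall i, u (i + n)%N = u i) ->
  \sum_(i < k * n) u i = k%:R * \sum_(i < n) u i.
Proof.
move=> per; elim: k => [|k IHk]; first by rewrite big_ord0 mul0r.
rewrite mulSn big_split_ord /=.
under [X in _ + X]eq_bigr do rewrite addnC per.
by rewrite IHk -natr1 mulrDl mul1r addrC.
Qed.

Lemma finField_prim_root (F : finFieldType) :
  {g : F | #|F|.-1.-primitive_root g}.
Proof.
suff /hasP/sig2W[g _ gP] : has #|F|.-1.-primitive_root (enum [pred x : F | x != 0]).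
  by exists g.
have F1 := finNzRing_gt1 F.
have cF : #|[pred x : F | x != 0]| = #|F|.-1 by rewrite cardC1.
apply: has_prim_root; rewrite ?enum_uniq -?cardE ?cF //; first by rewrite -subn1 subn_gt0.
apply/allP => x; rewrite mem_enum inE unity_rootE => x0.
apply/eqP; apply: (mulfI x0); by rewrite -exprS prednK ?mulr1 ?expf_card // ltnW.
Qed.

Section CubicSums.
Variables (F : finFieldType) (m : nat) (g : F).
Hypothesis cardF : #|F| = (6 * m).+1.
Hypothesis prim_g : (6 * m).-primitive_root g.

Let m_gt0 : (0 < m)%N.
Proof. by have := finNzRing_gt1 F; rewrite cardF; lia. Qed.

Let g_neq0 : g != 0.
Proof.
apply/eqP => g0; have := prim_expr_order prim_g.
by rewrite g0 expr0n; case: m m_gt0 => // k _ /eqP; rewrite eq_sym oner_eq0.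
Qed.

Lemma sum_neq0_prim_root (V : nmodType) (h : F -> V) :
  \sum_(x | x != 0) h x = \sum_(i < 6 * m) h (g ^+ i).
Proof.
set s := [seq g ^+ i | i : 'I_(6 * m)].
have us : uniq s.
  rewrite map_inj_uniq ?enum_uniq // => i j /eqP.
  by rewrite (eq_prim_root_expr prim_g) !modn_small // => /eqP/val_inj.
have ss : {subset s <= enum [pred x : F | x != 0]}.
  by move=> _ /mapP[i _ ->]; rewrite mem_enum inE expf_neq0.
have [|_ es] := uniq_min_size us ss.
  by rewrite -cardE cardC1 size_map size_enum_ord cardF.
rewrite -big_enum /= (perm_big s); last first.
  by rewrite perm_sym; apply: uniq_perm => //; exact: enum_uniq.
by rewrite big_map big_enum.
Qed.

Let nonzero_expf (x : F) : x != 0 -> x ^+ (6 * m) = 1.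
Proof. by move=> x0; apply: (mulfI x0); rewrite -exprS -cardF expf_card mulr1. Qed.

Let g_half : g ^+ (3 * m) = -1.
Proof.
have : (g ^+ (3 * m)) ^+ 2 == 1.
  by rewrite -exprM (_ : 3 * m * 2 = 6 * m)%N ?nonzero_expf //; lia.
rewrite sqrf_eq1 => /orP[|/eqP//]; rewrite -(expr0 g) (eq_prim_root_expr prim_g).
by rewrite mod0n modn_small; lia.
Qed.

Let neq1N1 : 1 != -1 :> F.
Proof.
rewrite -g_half -(expr0 g) (eq_prim_root_expr prim_g) mod0n modn_small; lia.
Qed.

(* The quadratic character of [F], by Euler's criterion. *)
Definition chi (x : F) : int :=
  if x ^+ (3 * m) == 1 then 1 else if x == 0 then 0 else -1.

Lemma chi_intr (x : F) : (chi x)%:~R = x ^+ (3 * m).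
Proof.
rewrite /chi; case: eqP => [->//|x1]; case: eqP => [->|/eqP x0].
  by rewrite expr0n; case: m m_gt0 => //.
have : (x ^+ (3 * m)) ^+ 2 == 1.
  by rewrite -exprM (_ : 3 * m * 2 = 6 * m)%N ?nonzero_expf //; lia.
by rewrite sqrf_eq1 => /orP[/eqP//|/eqP ->].
Qed.

Lemma chi_values (x : F) : chi x \in [:: 0; 1; -1].
Proof. by rewrite /chi; case: ifP => // _; case: ifP. Qed.

(** Euler's criterion gives identities for [chi] in [F] only; this lifts them to the integers. *)
Lemma intr_sign_inj : {in [:: 0; 1; -1] &, injective (intr : int -> F)}.
Proof.
have n10 : (1 == 0 :> F) = false by apply: negbTE; exact: oner_neq0.
have n1N : (1 == -1 :> F) = false by exact: negbTE.
move=> u v; rewrite !inE => /or3P[]/eqP-> /or3P[]/eqP-> //= /eqP;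
  rewrite ?rmorphN ?rmorph1 ?rmorph0 ?oppr_eq0 ?n10 ?n1N //.
- by rewrite eq_sym n10.
- by rewrite eq_sym oppr_eq0 n10.
- by rewrite eq_sym n1N.
Qed.

Lemma chiM : {morph chi : x y / x * y}.
Proof.
move=> x y; apply: intr_sign_inj; rewrite ?chi_values //; last first.
  by rewrite rmorphM /= !chi_intr exprMn.
have := chi_values x; have := chi_values y; rewrite !inE.
by move=> /or3P[]/eqP-> /or3P[]/eqP->.
Qed.

Lemma chi0 : chi 0 = 0.
Proof.
by rewrite /chi eqxx expr0n; case: m m_gt0 => // k _; rewrite eq_sym oner_eq0.
Qed.

Lemma chi1 : chi 1 = 1.
Proof. by rewrite /chi expr1n eqxx. Qed.

Lemma chi_sqr (x : F) : x != 0 -> chi x * chi x = 1.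
Proof.
by rewrite /chi => /negbTE->; case: ifP => _; rewrite ?mulr1 ?mulrNN.
Qed.

Lemma chi_prim_root : chi g = -1.
Proof.
by rewrite /chi g_half eq_sym (negbTE neq1N1) (negbTE g_neq0).
Qed.

(** Multiplying the index by [g] changes the sign of every term. *)
Lemma sum_chi : \sum_x chi x = 0.
Proof.
have : \sum_x chi x = - \sum_x chi x.
  rewrite [LHS](reindex_inj (mulfI g_neq0)) /= -sumrN.
  by apply: eq_bigr => x _; rewrite chiM chi_prim_root mulN1r.
lia.
Qed.

(* For [c != 0], [chi (c * (c + d)) = chi (1 + d / c)], and [c |-> d / c] is an
   involution of [F] (fixing [0], since [0^-1 = 0]). *)
Lemma sum_chi_mul_shift (a b : F) :
  \sum_c chi ((a + c) * (b + c)) = #|F|%:R * (a == b)%:R - 1.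
Proof.
rewrite (reindex_inj (addrI (- a))) /=.
under eq_bigr do rewrite addNKr addrA [X in chi (_ * X)]addrC.
rewrite (_ : (a == b) = (b - a == 0)); last by rewrite subr_eq0 eq_sym.
set d := b - a; have [->|d0] := eqVneq d 0.
  under eq_bigr do rewrite addr0 chiM.
  rewrite (bigD1 0) //= chi0 mul0r add0r (eq_bigr (fun=> 1)); last first.
    by move=> x; exact: chi_sqr.
  by rewrite sumr_const cardC1 mulr1 cardF /= -[(6 * m).+1%:R]natr1 addrK.
rewrite mulr0 sub0r (bigD1 0) //= mul0r chi0 add0r.
have inv : involutive (fun c : F => d / c).
  by move=> c /=; rewrite invfM invrK mulrA divff ?mul1r.
(* In this vanishing sum of [chi (1 + d / c)] the index [c = 0] contributes [chi 1 = 1], so the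
   other indices sum to [-1]. *)
have := sum_chi; rewrite (reindex_inj (addrI 1)) /= (reindex_inj (inv_inj inv)) /=.
rewrite (bigD1 0) //= invr0 mulr0 addr0 chi1 => /eqP.
rewrite addrC addr_eq0 => /eqP <-; apply: eq_bigr => c c0.
rewrite -[RHS]mul1r -(chi_sqr c c0) -!chiM; congr chi.
by field.
Qed.

(** With [w = g ^+ (2 * m)], a primitive cube root of unity, the solutions are [x], [w x] and
    [w^2 x]. *)
Lemma sum_cube_eq (x : F) : x != 0 -> \sum_y (y ^+ 3 == x ^+ 3)%:R = 3%:R :> int.
Proof.
move=> x0; pose w := g ^+ (2 * m).
have w1 : w - 1 != 0.
  rewrite subr_eq0 -(expr0 g) (eq_prim_root_expr prim_g) mod0n modn_small; lia.
have w2 : w ^+ 2 - 1 != 0.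
  rewrite subr_eq0 -exprM -(expr0 g) (eq_prim_root_expr prim_g) mod0n modn_small; lia.
have wx0 : w != 0 by rewrite expf_neq0.
have w3 : w ^+ 3 = 1.
  by rewrite -exprM (_ : 2 * m * 3 = 6 * m)%N ?nonzero_expf //; lia.
have ws : w ^+ 2 = - w - 1.
  by apply: (mulfI w1); rewrite mulrBl mul1r -exprS w3; ring.
rewrite -natr_sum -(big_mkcond (fun y => y ^+ 3 == x ^+ 3) (fun=> 1%N)) sum1_card.
have us : uniq [:: x; w * x; w ^+ 2 * x].
  rewrite /= !inE !negb_or andbT -{1 3}[x]mul1r !(inj_eq (mulIf x0)).
  rewrite ![1 == _]eq_sym -![_ == 1]subr_eq0 w1 w2 /=.
  by rewrite -{1}[w]mulr1 expr2 (inj_eq (mulfI wx0)) eq_sym -subr_eq0.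
have -> : #|(fun y => y ^+ 3 == x ^+ 3)| = size [:: x; w * x; w ^+ 2 * x].
  rewrite -(card_uniqP us); apply: eq_card => y.
  rewrite !inE -[y == x]subr_eq0 -[y == w * x]subr_eq0 -[y == _ * x]subr_eq0.
  rewrite orbA -!mulf_eq0 unfold_in -subr_eq0; congr (_ == 0).
  (* The identity holds for any [w]; the multiple of [w^2 + w + 1] is kept explicit so that [ws] can
     cancel it afterwards. *)
  have -> : (y - x) * (y - w * x) * (y - w ^+ 2 * x)
      = y ^+ 3 - w ^+ 3 * x ^+ 3 + (w ^+ 2 + w + 1) * (w * x ^+ 2 * y - x * y ^+ 2).
    by ring.
  by rewrite ws w3 mul1r; ring.
by [].
Qed.

(** This is the number of affine points of the curve [y^2 = x^3 + c], less [#|F|]. *)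
Definition cubic_sum (c : F) : int := \sum_x chi (x ^+ 3 + c).

(** Substitute [d x] for [x] and use [chi (d^3) = chi d]. Up to sign, then, the sum depends only on
    the class of [c] modulo cubes. *)
Lemma cubic_sum_mul_cube (c d : F) : d != 0 ->
  cubic_sum (c * d ^+ 3) = chi d * cubic_sum c.
Proof.
move=> d0; rewrite /cubic_sum (reindex_inj (mulfI d0)) /= mulr_sumr.
apply: eq_bigr => x _.
rewrite (_ : _ + _ = d * d * d * (x ^+ 3 + c)); last by ring.
by rewrite !chiM (chi_sqr d d0) mul1r.
Qed.

Lemma cubic_sum0 : cubic_sum 0 = 0.
Proof.
rewrite -[RHS]sum_chi; apply: eq_bigr => x _; rewrite addr0.
have [->|x0] := eqVneq x 0; first by rewrite expr0n.
by rewrite !exprS expr0 mulr1 !chiM (chi_sqr x x0) mulr1.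
Qed.

(** Exchanging sums, the total of [chi c * cubic_sum c] is [#|F|], from [x = 0], minus [#|F|], from
    the [-1] for each [x]. *)
Lemma cubic_sum_first_moment :
  cubic_sum 1 - cubic_sum g + cubic_sum (g ^+ 2) = 0.
Proof.
have e : \sum_c chi c * cubic_sum c = 0.
  under eq_bigr do rewrite mulr_sumr.
  rewrite exchange_big /=.
  under eq_bigr => x _.
    under eq_bigr => c _ do rewrite -chiM -[c in c * _]add0r.
    rewrite sum_chi_mul_shift; over.
  rewrite big_split /= sumrN sumr_const -mulr_sumr (bigD1 0) //= expr0n eqxx.
  rewrite big1 ?addr0 ?mulr1 ?subrr // => x x0.
  by rewrite eq_sym expf_eq0 (negbTE x0).
move: e; rewrite (bigD1 0) //= chi0 mul0r add0r sum_neq0_prim_root.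
(* The summand is invariant under multiplication of [c] by [g^3], so the sum over all powers of [g]
   is [2 m] times that over [1, g, g^2]. *)
rewrite (_ : 6 * m = 2 * m * 3)%N; last by lia.
rewrite (@sum_periodic (fun i => chi (g ^+ i) * cubic_sum (g ^+ i))); last first.
  move=> i; rewrite exprD cubic_sum_mul_cube // chiM.
  rewrite !exprS expr0 mulr1 !chiM chi_prim_root; ring.
rewrite !big_ord_recr big_ord0 /= expr0 expr1 expr2 chiM chi1 chi_prim_root.
move/eqP; rewrite mulf_eq0 => /orP[|/eqP <-]; last by ring.
by rewrite pnatr_eq0; lia.
Qed.

(** With [q = #|F|], there are [1 + 3 (q - 1)] pairs with equal cubes, so the total of the squares
    is [q (1 + 3 (q - 1)) - q^2 = 2 q (q - 1)]. It consists of [2 m = (q - 1) / 3] equal periods. *)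
Lemma cubic_sum_second_moment :
  cubic_sum 1 ^+ 2 + cubic_sum g ^+ 2 + cubic_sum (g ^+ 2) ^+ 2 = 6 * #|F|%:R.
Proof.
have e : \sum_c cubic_sum c ^+ 2 = 2 * #|F|%:R * (#|F|%:R - 1).
  under eq_bigr do rewrite expr2 mulr_suml.
  rewrite exchange_big /=.
  under eq_bigr => x _.
    under eq_bigr => c _ do rewrite mulr_sumr.
    rewrite exchange_big /=.
    under eq_bigr => y _.
      under eq_bigr => c _ do rewrite -chiM.
      rewrite sum_chi_mul_shift eq_sym; over.
    rewrite big_split /= sumrN sumr_const -mulr_sumr; over.
  rewrite big_split /= sumrN sumr_const -mulr_sumr (bigD1 0) //=.
  rewrite (bigD1 0) //= eqxx big1 => [|y y0]; last by rewrite expr0n expf_eq0 (negbTE y0).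
  under eq_bigr => x x0 do rewrite sum_cube_eq //.
  rewrite sumr_const cardC1 -[_ *+ #|xpredT|]mulr_natr -[_ *+ #|F|.-1]mulr_natr cardF /=.
  rewrite -[(6 * m).+1%:R]natr1; ring.
move: e; rewrite (bigD1 0) //= cubic_sum0 expr0n add0r sum_neq0_prim_root.
rewrite (_ : 6 * m = 2 * m * 3)%N; last by lia.
rewrite (@sum_periodic (fun i => cubic_sum (g ^+ i) ^+ 2)); last first.
  by move=> i; rewrite exprD cubic_sum_mul_cube // exprMn expr2 chi_sqr ?mul1r.
rewrite !big_ord_recr big_ord0 /= expr0 expr1 add0r => e.
have m0 : (2 * m)%:R != 0 :> int by rewrite pnatr_eq0; lia.
by apply: (mulfI m0); rewrite e cardF -natr1 !natrM; ring.
Qed.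

(** Nonzero [x] fall into triples with a common cube, and [x = 0] contributes [chi 1 = 1]. *)
Lemma cubic_sum1_mod3 : exists t : int, cubic_sum 1 = 1 + 3 * t.
Proof.
exists (\sum_(i < 2 * m) chi ((g ^+ i) ^+ 3 + 1)).
rewrite /cubic_sum (bigD1 0) //= expr0n add0r chi1 sum_neq0_prim_root.
rewrite (_ : 6 * m = 3 * (2 * m))%N; last by lia.
rewrite (@sum_periodic (fun i => chi ((g ^+ i) ^+ 3 + 1))) // => i.
rewrite exprD exprMn -[(g ^+ (2 * m)) ^+ 3]exprM.
by rewrite (_ : 2 * m * 3 = 6 * m)%N ?nonzero_expf ?mulr1 //; lia.
Qed.

(** Every term is odd except at the three roots of [x^3 = -1], and [#|F| - 3 = 6 m - 2] is even. *)
Lemma cubic_sum1_even : exists s : int, cubic_sum 1 = 2 * s.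
Proof.
pose neg x : int := if chi x == -1 then 1 else 0.
have chiE x : chi x = 1 - (x == 0)%:R - 2 * neg x.
  rewrite /neg; have [->|x0] := eqVneq x 0; first by rewrite chi0.
  by have := chi_sqr x x0; have := chi_values x; rewrite !inE => /or3P[]/eqP->.
exists (3 * m%:R - 1 - \sum_x neg (x ^+ 3 + 1)).
have cubeE (x : F) : (x ^+ 3 + 1 == 0) = (x ^+ 3 == (-1) ^+ 3).
  by rewrite addr_eq0; congr (_ == _); ring.
rewrite /cubic_sum; under eq_bigr do rewrite chiE cubeE.
rewrite !sumrB -mulr_sumr sumr_const sum_cube_eq ?oppr_eq0 ?oner_eq0 //.
rewrite -[_ *+ _]mulr_natr cardF -[(6 * m).+1%:R]natr1 natrM; ring.
Qed.

Lemma natr_card_finField : #|F|%:R = 0 :> F.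
Proof.
have : \sum_(x : F) (x + 1) = \sum_(x : F) x by rewrite [RHS](reindex_inj (addIr 1)).
by rewrite big_split /= -[RHS]addr0 => /addrI; rewrite sumr_const.
Qed.

(** If [6 m] does not divide [k], multiplying the index by [g] scales the sum by [g^k], which is not
    1. Positivity of [k] makes the term at 0 vanish; for [k = 0] the sum would be [#|F| = 0], not
    [-1]. *)
Lemma sum_expf (k : nat) : (0 < k)%N ->
  \sum_(x : F) x ^+ k = if (6 * m %| k)%N then -1 else 0.
Proof.
move=> k0; case: ifPn => [/dvdnP[j ej]|dk].
  rewrite (bigD1 0) //= expr0n gtn_eqF // add0r.
  rewrite (eq_bigr (fun=> 1)) => [|x x0]; last first.
    by rewrite ej mulnC exprM nonzero_expf // expr1n.
  have := natr_card_finField; rewrite sumr_const cardC1 cardF -natr1 /= => /eqP.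
  by rewrite addr_eq0 => /eqP.
have gk : g ^+ k - 1 != 0.
  by rewrite subr_eq0 -(expr0 g) (eq_prim_root_expr prim_g) mod0n.
apply: (mulfI gk); rewrite mulr0 mulrBl mul1r mulr_sumr.
rewrite [X in _ - X](reindex_inj (mulfI g_neq0)) /=.
by under [X in _ - X]eq_bigr do rewrite exprMn; rewrite subrr.
Qed.

(** Expand [(1 + x^3)^(3m)] and sum over [x]: for [0 < i <= 3m], the exponent [3 i] is a multiple of
    [6 m] only when [i = 2 m], and [i = 0] gives [#|F| = 0]. *)
Lemma cubic_sum1_intr : (cubic_sum 1)%:~R = - 'C(3 * m, m)%:R :> F.
Proof.
rewrite /cubic_sum rmorph_sum /=.
under eq_bigr do rewrite chi_intr addrC exprDn.
rewrite exchange_big /=.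
have m3 : (2 * m < (3 * m).+1)%N by lia.
rewrite (bigD1 (Ordinal m3)) //= [X in _ + X]big1 ?addr0 => [|i im].
  under eq_bigr do rewrite expr1n mul1r -exprM.
  rewrite sumrMnl sum_expf; last by lia.
  rewrite (_ : 3 * (2 * m) = 6 * m)%N ?dvdnn; last by lia.
  rewrite mulNrn -bin_sub; last by lia.
  by congr (- 'C(_, _)%:R); lia.
under eq_bigr do rewrite expr1n mul1r -exprM.
rewrite sumrMnl.
have [->|i0] := posnP i.
  by under eq_bigr do rewrite muln0 expr0; rewrite sumr_const natr_card_finField mul0rn.
rewrite sum_expf; last by lia.
case: ifPn => [/dvdnP[j ej]|_]; last by rewrite mul0rn.
case/eqP: im; apply: val_inj => /=.
have := ltn_ord i; move: (nat_of_ord i) i0 ej => {}i i0 ej i3.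
have j1 : j = 1%N by nia.
by rewrite j1 in ej; lia.
Qed.

End CubicSums.

(** * Existence and uniqueness of the representation [a^2 + 3 b^2] *)

Lemma int_sqr_eq_mul3 (e t : int) : e ^+ 2 = 3 * t -> exists b, e = 3 * b.
Proof.
move=> et; exists (e %/ 3)%Z.
have := divz_eq e 3; have := modz_ge0 e (isT : 3 != 0 :> int).
have := ltz_pmod e (isT : 0 < 3 :> int).
move: (e %/ 3)%Z (e %% 3)%Z => b r r3 r0 eb.
have [r0'|[r1|r2]] : r = 0 \/ (r = 1 \/ r = 2) by lia.
- lia.
- exfalso; rewrite eb r1 in et; nia.
- exfalso; rewrite eb r2 in et; nia.
Qed.

(** Eliminating [T1] and putting [T0 = 2 s] gives [(T2 + s)^2 + 3 s^2 = 3 q], so [T2 + s = 3 b] and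
    [q = s^2 + 3 b^2]; the residue of [T0] modulo 3 forces the choice [a = - s]. *)
Lemma sqr_add_3sqr_of_moments (q T0 T1 T2 : int) :
  T0 - T1 + T2 = 0 -> T0 ^+ 2 + T1 ^+ 2 + T2 ^+ 2 = 6 * q ->
  (exists s, T0 = 2 * s) -> (exists t, T0 = 1 + 3 * t) ->
  exists a b : int, [/\ q = a ^+ 2 + 3 * b ^+ 2, (3 %| a - 1)%Z & T0 = - 2 * a].
Proof.
move=> e1 e2 [s es] [t et].
have [b eb] : exists b, T2 + s = 3 * b.
  apply: (@int_sqr_eq_mul3 _ (q - s ^+ 2)).
  have eT1 : T1 = T0 + T2 by lia.
  rewrite eT1 es in e2; nia.
exists (- s), b; split.
- have eT1 : T1 = T0 + T2 by lia.
  have eT2 : T2 = 3 * b - s by lia.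
  rewrite eT1 eT2 es in e2; nia.
- by apply/dvdzP; exists (t - s); lia.
- by rewrite es; ring.
Qed.

(** Composition of forms gives [p^2 = (a A + 3 b B)^2 + 3 (a B - A b)^2]. If [a B - A b = t p], then
    [3 t^2 <= 1], so [t = 0]. *)
Lemma sqr_add_3sqr_unique_aux (p : nat) (a b A B : int) :
  (0 < p)%N -> p%:Z = a ^+ 2 + 3 * b ^+ 2 -> p%:Z = A ^+ 2 + 3 * B ^+ 2 ->
  (p%:Z %| a * B - A * b)%Z -> a ^+ 2 = A ^+ 2.
Proof.
move=> p0 e1 e2 /dvdzP[t et].
have e3 : p%:Z ^+ 2 = (a * A + 3 * b * B) ^+ 2 + 3 * (a * B - A * b) ^+ 2.
  by rewrite {1}[p%:Z ^+ 2]expr2 {1}e1 e2; ring.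
have t0 : t = 0.
  rewrite et in e3.
  have : p%:Z ^+ 2 * (3 * t ^+ 2) <= p%:Z ^+ 2 * 1.
    rewrite mulr1 [leRHS]e3 -subr_ge0.
    rewrite (_ : _ - _ = (a * A + 3 * b * B) ^+ 2); last by ring.
    exact: sqr_ge0.
  rewrite ler_pM2l; first by move=> h; clear -h; nia.
  by rewrite exprn_gt0 // ltz_nat.
have e4 : a * B = A * b by move: et; rewrite t0 mul0r => /eqP; rewrite subr_eq0 => /eqP.
have e5 : p%:Z * B ^+ 2 = p%:Z * b ^+ 2.
  transitivity (A ^+ 2 * b ^+ 2 + 3 * b ^+ 2 * B ^+ 2); last by rewrite e2; ring.
  by rewrite -exprMn -e4 e1; ring.
have pz : p%:Z != 0 by lia.
move/(mulfI pz): e5 => e5; rewrite e5 in e2.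
by rewrite e1 in e2; lia.
Qed.

(** Since [(a B - A b) (a B + A b) = p (B^2 - b^2)], the prime [p] divides one factor; replacing [b]
    by [- b] exchanges the two. The residue modulo 3 then excludes [a = - A]. *)
Lemma sqr_add_3sqr_unique (p : nat) (a b A B : int) :
  prime p -> p%:Z = a ^+ 2 + 3 * b ^+ 2 -> p%:Z = A ^+ 2 + 3 * B ^+ 2 ->
  (3 %| a - 1)%Z -> (3 %| A - 1)%Z -> a = A.
Proof.
move=> pp e1 e2 /dvdzP[u eu] /dvdzP[v ev].
have p0 := prime_gt0 pp.
have aA : a ^+ 2 = A ^+ 2.
  have : (p%:Z %| (a * B - A * b) * (a * B - A * - b))%Z.
    apply/dvdzP; exists (B ^+ 2 - b ^+ 2).
    rewrite [RHS]mulrBl {1}e1 e2; ring.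
  rewrite dvdzE abszM Euclid_dvdM // => /orP[d|d].
    exact: (@sqr_add_3sqr_unique_aux p a b A B).
  by apply: (@sqr_add_3sqr_unique_aux p a (- b) A B) => //; rewrite sqrrN.
move/eqP: aA; rewrite eqf_sqr => /orP[/eqP//|/eqP]; lia.
Qed.

(** * Reduction modulo [p] of rationals with denominator prime to [p] *)

Section Reduction.
Variable p : nat.
Hypothesis p_prime : prime p.

Lemma numq_mul_eq (x : rat) (a d : int) :
  d%:~R != 0 :> rat -> x = a%:~R / d%:~R -> numq x * d = a * denq x.
Proof.
move=> d0 ex; apply: (@intr_inj rat); rewrite !rmorphM /=; apply/eqP.
by rewrite -eqr_div // ?intr_eq0 ?denq_neq0 // divq_num_den ex.
Qed.

(** The graph of the map from the integers localized at [p] to ['F_p]. The fraction need not be in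
    lowest terms, which makes closure under the field operations immediate. *)
Definition reduces_to (x : rat) (u : 'F_p) : Prop :=
  exists a d : int, [/\ d%:~R != 0 :> 'F_p, x = a%:~R / d%:~R & u = a%:~R / d%:~R].

Let Fp_eq0 (a : int) : (a%:~R == 0 :> 'F_p) = (p%:Z %| a)%Z.
Proof. by rewrite (dvdz_pcharf (pchar_Fp p_prime)). Qed.

Let rat_neq0 (d : int) : d%:~R != 0 :> 'F_p -> d%:~R != 0 :> rat.
Proof. by rewrite intr_eq0; apply: contraNneq => ->. Qed.

Lemma reduces_to_int (a : int) : reduces_to a%:~R a%:~R.
Proof. by exists a, 1; rewrite !divr1 oner_neq0. Qed.

Lemma reduces_to_nat (n : nat) : reduces_to n%:R n%:R.
Proof. exact: (reduces_to_int n). Qed.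

Lemma reduces_toD x y u v :
  reduces_to x u -> reduces_to y v -> reduces_to (x + y) (u + v).
Proof.
move=> [a [d [d0 -> ->]]] [b [e [e0 -> ->]]].
exists (a * e + b * d), (d * e).
by rewrite !rmorphD !rmorphM /= mulf_neq0 // !addf_div // !rat_neq0.
Qed.

Lemma reduces_toM x y u v :
  reduces_to x u -> reduces_to y v -> reduces_to (x * y) (u * v).
Proof.
move=> [a [d [d0 -> ->]]] [b [e [e0 -> ->]]].
exists (a * b), (d * e).
by rewrite !rmorphM /= mulf_neq0 // !mulf_div.
Qed.

Lemma reduces_toV x u : u != 0 -> reduces_to x u -> reduces_to x^-1 u^-1.
Proof.
move=> u0 [a [d [d0 ex eu]]]; exists d, a.
rewrite ex eu !invf_div; split=> //.
by apply: contraNneq u0 => a0; rewrite eu a0 mul0r.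
Qed.

Lemma reduces_toX n x u : reduces_to x u -> reduces_to (x ^+ n) (u ^+ n).
Proof.
move=> xu; elim: n => [|n IHn]; first exact: (reduces_to_int 1).
by rewrite !exprS; exact: reduces_toM.
Qed.

Lemma reduces_to_sum n (x : nat -> rat) (u : nat -> 'F_p) :
  (forall k, (k < n)%N -> reduces_to (x k) (u k)) ->
  reduces_to (\sum_(k < n) x k) (\sum_(k < n) u k).
Proof.
elim: n => [|n IHn] xu; first by rewrite !big_ord0; exact: (reduces_to_int 0).
by rewrite !big_ord_recr; apply: reduces_toD; [apply: IHn => k /ltnW|]; apply: xu.
Qed.

(** The reduced denominator divides any other denominator [d], and [p] does not divide [d]. *)
Lemma reduces_to_coprime x u : reduces_to x u -> coprime p `|denq x|%N.
Proof.
move=> [a [d [d0 ex _]]]; have := d0; rewrite Fp_eq0 dvdzE /= -prime_coprime //.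
apply: coprime_dvdr; rewrite -dvdzE -(@Gauss_dvdzr _ (numq x)).
  by apply/dvdzP; exists a; apply: numq_mul_eq => //; exact: rat_neq0.
by rewrite coprimezE coprime_sym coprime_num_den.
Qed.

Lemma rat_eqmod_reduces_to x y u :
  reduces_to x u -> reduces_to y u -> rat_eqmod p x y.
Proof.
move=> xu yu; split; [exact: reduces_to_coprime xu | exact: reduces_to_coprime yu |].
have : reduces_to (x - y) 0.
  rewrite -(subrr u) -[- y]mulN1r -[- u]mulN1r; apply: reduces_toD => //.
  by apply: reduces_toM => //; exact: (reduces_to_int (- 1)).
move=> [a [d [d0 ex /esym/eqP]]].
rewrite mulf_eq0 invr_eq0 (negbTE d0) orbF Fp_eq0 => pa.
have : (p%:Z %| numq (x - y) * d)%Z.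
  by rewrite (@numq_mul_eq _ a d) ?rat_neq0 // dvdz_mulr.
rewrite !dvdzE abszM Euclid_dvdM // => /orP[//|pd].
by case/negP: d0; rewrite Fp_eq0 dvdzE.
Qed.

End Reduction.

(** * The terms of the sum in ['F_p], and the theorem *)

Section Terms.
Variable p : nat.
Hypotheses (p_prime : prime p) (p_gt5 : (5 < p)%N).

Let natr_Fp_eq0 (n : nat) : (n%:R == 0 :> 'F_p) = (p %| n)%N.
Proof. by rewrite (dvdn_pcharf (pchar_Fp p_prime)). Qed.

Lemma natr_Fp_neq0 (n : nat) : (0 < n < p)%N -> n%:R != 0 :> 'F_p.
Proof.
case/andP=> n0 np; rewrite natr_Fp_eq0; apply/negP => /(dvdn_leq n0).
by rewrite leqNgt np.
Qed.

Lemma fact_Fp_neq0 (k : nat) : (k < p)%N -> k`!%:R != 0 :> 'F_p.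
Proof.
elim: k => [|k IHk] kp; first by rewrite fact0 oner_neq0.
by rewrite factS natrM mulf_neq0 ?IHk ?natr_Fp_neq0 //; lia.
Qed.

(** The denominator is a unit because [k < p] and [p] exceeds 3; the powers combine as
    [(-27)^k / 54^k = (-1/2)^k]. *)
Lemma reduces_to_term (n k : nat) :
  9%:R * (n%:R * (n%:R + 1)) = - 2%:R :> 'F_p -> (k <= n < p)%N ->
  reduces_to p (term k) ('C(n, k)%:R * 'C(n + k, k)%:R * (- 2%:R^-1) ^+ k).
Proof.
move=> hn /andP[kn np].
have n2 : 2%:R != 0 :> 'F_p by apply: natr_Fp_neq0; lia.
have n3 : 3%:R != 0 :> 'F_p by apply: natr_Fp_neq0; lia.
have nf : k`!%:R != 0 :> 'F_p by apply: fact_Fp_neq0; lia.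
have e27 : 27%:R = 3%:R ^+ 3 :> 'F_p by ring.
have e54 : 54%:R = 2%:R * 27%:R :> 'F_p by ring.
have n27 : 27%:R != 0 :> 'F_p by rewrite e27 expf_neq0.
have n54 : 54%:R != 0 :> 'F_p by rewrite e54 mulf_neq0.
have nd : (54 ^ k * k`! ^ 3)%N%:R != 0 :> 'F_p.
  by rewrite natrM !natrX mulf_neq0 ?expf_neq0.
have -> : 'C(n, k)%:R * 'C(n + k, k)%:R * (- 2%:R^-1) ^+ k
   = (3 * k)`!%:R / (54 ^ k * k`! ^ 3)%N%:R :> 'F_p.
  apply: (mulIf nd); rewrite divfK // (@fact3_bin _ n) // natrM (natrX _ 54) !mulrA.
  congr (_ * _); rewrite -[LHS]mulrA -exprMn; congr (_ * _ ^+ _).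
  by rewrite e54 mulNr mulrA mulVf ?mul1r.
apply: reduces_toM => //; first exact: reduces_to_nat.
by apply: reduces_toV => //; exact: reduces_to_nat.
Qed.

End Terms.

Theorem theorem2p5 (p : nat) :
  prime p -> (5 < p)%N ->
  ((6 %| p - 5)%N ->
     rat_eqmod p (\sum_(k < (p %/ 3).+1) term k) 0)
  /\ ((6 %| p - 1)%N -> forall A B : int, p%:Z = A ^+ 2 + 3 * B ^+ 2 ->
     (3 %| A - 1)%Z ->
     rat_eqmod p (\sum_(k < (p %/ 3).+1) term k) (2 * A%:~R))
  /\ ((6 %| p - 1)%N ->
     rat_eqmod p (\sum_(k < (p %/ 3).+1) (k%:R * term k)) 0)
  /\ ((6 %| p - 5)%N ->
     rat_eqmod p (\sum_(k < (p %/ 3).+1) (k%:R * term k))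
       (3%:R^-1 * (-1) ^+ ((p.+1) %/ 6) * (2%:R ^- ((p.+1) %/ 3))
          * ('C((p.+1) %/ 3, (p.+1) %/ 6))%:R)).
Proof.
move=> pp p5; have pch := pchar_Fp pp.
have p0 : p%:R = 0 :> 'F_p by rewrite pcharf0.
have n2 : 2%:R != 0 :> 'F_p by apply: natr_Fp_neq0 => //; lia.
have n4 : 4%:R != 0 :> 'F_p by apply: natr_Fp_neq0 => //; lia.
have n3 : 3%:R != 0 :> 'F_p by apply: natr_Fp_neq0 => //; lia.
have sum_term : forall n, 9%:R * (n%:R * (n%:R + 1)) = - 2%:R :> 'F_p -> (n < p)%N ->
    reduces_to p (\sum_(k < n.+1) term k)
      (\sum_(k < n.+1) 'C(n, k)%:R * 'C(n + k, k)%:R * (- 2%:R^-1) ^+ k) /\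
    reduces_to p (\sum_(k < n.+1) k%:R * term k)
      (\sum_(k < n.+1) k%:R * ('C(n, k)%:R * 'C(n + k, k)%:R * (- 2%:R^-1) ^+ k)).
  move=> n hn np; split.
    apply: (@reduces_to_sum _ _ term
      (fun k => 'C(n, k)%:R * 'C(n + k, k)%:R * (- 2%:R^-1) ^+ k)) => k kn.
    by apply: reduces_to_term => //; rewrite np andbT -ltnS.
  apply: (@reduces_to_sum _ _ (fun k => k%:R * term k)
    (fun k => k%:R * ('C(n, k)%:R * 'C(n + k, k)%:R * (- 2%:R^-1) ^+ k))) => k kn.
  apply: reduces_toM => //; first exact: reduces_to_nat.
  by apply: reduces_to_term => //; rewrite np andbT -ltnS.
(* With [n = p %/ 3], here [3 n = p - 2], so [9 n (n + 1) = 3 n (3 n + 3) = (-2) 1] in ['F_p]. *)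
have case5 : (6 %| p - 5)%N -> exists j, [/\ p = (6 * j + 5)%N, (p %/ 3 = j.*2.+1)%N
    & 9%:R * ((p %/ 3)%:R * ((p %/ 3)%:R + 1)) = - 2%:R :> 'F_p].
  move=> /dvdnP[j ej]; exists j; have e : (p %/ 3 = j.*2.+1)%N by lia.
  split=> //; first by lia.
  have : (3 * (p %/ 3) + 2)%:R = 0 :> 'F_p by rewrite -p0; congr _%:R; lia.
  rewrite natrD natrM => /eqP; rewrite addr_eq0 => /eqP e3.
  rewrite (_ : 9%:R * _ = 3%:R * (p %/ 3)%:R * (3%:R * (p %/ 3)%:R + 3%:R)); last by ring.
  by rewrite e3; ring.
(* Here [3 n = p - 1], and the same product is [(-1) 2]. *)
have case1 : (6 %| p - 1)%N -> exists m, [/\ p = (6 * m).+1, (p %/ 3 = m.*2)%N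
    & 9%:R * ((p %/ 3)%:R * ((p %/ 3)%:R + 1)) = - 2%:R :> 'F_p].
  move=> /dvdnP[m em]; exists m; have e : (p %/ 3 = m.*2)%N by lia.
  split=> //; first by lia.
  have : (3 * (p %/ 3) + 1)%:R = 0 :> 'F_p by rewrite -p0; congr _%:R; lia.
  rewrite natrD natrM => /eqP; rewrite addr_eq0 => /eqP e3.
  rewrite (_ : 9%:R * _ = 3%:R * (p %/ 3)%:R * (3%:R * (p %/ 3)%:R + 3%:R)); last by ring.
  by rewrite e3; ring.
have np : (p %/ 3 < p)%N by lia.
split; [|split; [|split]].
- move=> /case5[j [pj nj hn]]; apply: (@rat_eqmod_reduces_to _ pp _ _ 0); last exact: (reduces_to_int _ 0).
  rewrite -[X in reduces_to _ _ X](@sum_bin_bin_half_odd _ n2 (p %/ 3)).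
    by have [] := sum_term _ hn np.
  by rewrite nj /= odd_double.
- move=> /case1[m [pm nm hn]] A B eAB A3.
  have [h _] := sum_term _ hn np; move: h; rewrite nm.
  set s := (X in reduces_to _ _ X) => hs.
  suff es : s = 2 * A%:~R.
    apply: (@rat_eqmod_reduces_to _ pp _ _ _ hs); rewrite es.
    by apply: reduces_toM; [exact: (reduces_to_int _ 2)|exact: reduces_to_int].
  have cF : #|'F_p| = (6 * m).+1 by rewrite card_Fp.
  have [g] := finField_prim_root 'F_p; rewrite cF => pg.
  have [a [b [eab a3 Sa]]] := @sqr_add_3sqr_of_moments _ _ _ _
    (@cubic_sum_first_moment _ _ _ cF pg) (@cubic_sum_second_moment _ _ _ cF pg)
    (@cubic_sum1_even _ _ _ cF pg) (@cubic_sum1_mod3 _ _ _ cF pg).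
  have {}eab : p%:Z = a ^+ 2 + 3 * b ^+ 2 by rewrite -eab card_Fp // natz.
  rewrite -(@sqr_add_3sqr_unique _ _ _ _ _ pp eab eAB a3 A3).
  have := @cubic_sum1_intr _ _ _ cF pg.
  rewrite Sa => eS.
  have -> : s = 'C(3 * m, m)%:R.
    apply: (mulfI (expf_neq0 m n4)); rewrite sum_bin_bin_half_even //.
    apply: central_bin_half; [|lia|by apply: fact_Fp_neq0 => //; lia].
    have : (2 * (3 * m) + 1)%:R = 0 :> 'F_p by rewrite -p0; congr _%:R; lia.
    by rewrite natrD natrM => /eqP; rewrite addr_eq0 => /eqP.
  by rewrite -[LHS]opprK -eS rmorphM rmorphN /=; ring.
- move=> /case1[m [pm nm hn]]; apply: (@rat_eqmod_reduces_to _ pp _ _ 0); last exact: (reduces_to_int _ 0).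
  rewrite -[X in reduces_to _ _ X](@sum_mul_bin_bin_half_even _ n2 m) -nm.
  by have [] := sum_term _ hn np.
move=> /case5[j [pj nj hn]].
have [_ h] := sum_term _ hn np; move: h; rewrite nj.
set s := (X in reduces_to _ _ X) => hs.
apply: (@rat_eqmod_reduces_to _ pp _ _ _ hs).
rewrite (_ : p.+1 %/ 3 = j.+1.*2)%N; last by lia.
rewrite (_ : p.+1 %/ 6 = j.+1)%N; last by lia.
have -> : s = 3%:R^-1 * (-1) ^+ j.+1 * (2%:R ^+ j.+1.*2)^-1 * 'C(j.+1.*2, j.+1)%:R.
  apply: (mulfI (expf_neq0 j n4)); rewrite sum_mul_bin_bin_half_odd //.
  (* Since [6 (j + 1) = p + 1], the factor [j + 1] in the recurrence for central binomials is [1/6];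
     this is how [(2j+1) C(2j, j)] becomes a multiple of [C(2j+2, j+1)]. *)
  have j6 : 6%:R * j.+1%:R = 1 :> 'F_p.
    by rewrite -natrM (_ : 6 * j.+1 = p + 1)%N ?natrD ?p0 ?add0r //; lia.
  have eC : 'C(j.+1.*2, j.+1)%:R = 12%:R * (j.*2.+1%:R * 'C(j.*2, j)%:R) :> 'F_p.
    have := congr1 (fun i => i%:R : 'F_p) (mul_central_bin j); rewrite /= !natrM => e.
    transitivity (6%:R * j.+1%:R * 'C(j.+1.*2, j.+1)%:R : 'F_p).
      by rewrite j6 mul1r.
    by rewrite -mulrA e; ring.
  have -> : 2%:R ^+ j.+1.*2 = 4%:R * 4%:R ^+ j :> 'F_p.
    rewrite -mul2n exprM -exprS; congr (_ ^+ _); ring.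
  have n4j := expf_neq0 j n4.
  rewrite eC exprS; field.
  by rewrite n3 n4 n4j.
apply: reduces_toM => //; last exact: reduces_to_nat.
apply: reduces_toM => //; last first.
  by apply: reduces_toV; [rewrite expf_neq0|apply: reduces_toX => //; exact: reduces_to_nat].
apply: reduces_toM => //.
  by apply: reduces_toV => //; exact: reduces_to_nat.
by apply: reduces_toX => //; exact: (reduces_to_int _ (-1)).
Qed.
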